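(* Let $K$ be a field with a non-trivial valuation $v$ and let $A(x)=\sum_{i=0}^n a_ix^i\in K[x]$ be a polynomial of degree $n$. Assume that the characteristic of the residue field of $v$ does not divide $n$. If the orbit $A(x)U(2,K)$ contains an Eisenstein–Dumas polynomial at $v$, then $$U(A(x))=A(x)\begin{pmatrix}1&-\frac{a_{n-1}}{na_n}\\0&1\end{pmatrix}=A\Big(x-\frac{a_{n-1}}{na_n}\Big)$$ is an Eisenstein–Dumas polynomial at $v$.
   Context: $v:K\to\Gamma\cup\{\infty\}$ is a non-trivial Krull valuation with values in a linearly ordered abelian group $\Gamma$; $K$ is not assumed henselian; the residue field is $R_v/M_v$ with $R_v=\{v\ge0\}$, $M_v=\{v>0\}$. $U(2,K)$ is the group of invertible upper triangular $2\times2$ matrices over $K$. Action: for $A$ of degree $n$, $A(x)\begin{pmatrix}a&b\\c&d\end{pmatrix}=(cx+d)^nA\big(\frac{ax+b}{cx+d}\big)$, regarded as a polynomial of formal degree $n$; $A(x)U(2,K)=\{A(x)g:g\in U(2,K)\}$. A polynomial written $\sum_{i=0}^n b_ix^i$ is Eisenstein–Dumas at $v$ if (D0) $b_0b_n\neq0$; (D1) $v(b_0)-v(b_n)\notin k\Gamma=\{kg:g\in\Gamma\}$ for every integer $k>1$ dividing $n$; (D2) $nv(b_i)\ge (n-i)v(b_0)+iv(b_n)$ for $0\le i\le n$.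
   Formalization: The degree n is assumed to be greater than 1; for n = 1 the claim fails, since the orbit of A(x) = x contains the Eisenstein–Dumas polynomial x + 1, while U(A(x)) = x has zero constant term and violates (D0). *)

(* Defs.v *)
From HB Require Import structures.
From mathcomp Require Import all_boot all_order all_algebra.

Set Implicit Arguments.
Unset Strict Implicit.
Unset Printing Implicit Defensive.

Import Order.TTheory GRing.Theory Num.Theory.
Local Open Scope ring_scope.
Local Open Scope quotient_scope.

HB.mixin Record POrderedZmodule_isLinear G of Num.POrderedZmodule G := {
  ordz_total : total (<=%R : rel G);
  ordzD2l_subproof : forall z x y : G, x <= y -> z + x <= z + y
}.

(* Totality is an axiom over the partial order rather than an instance of
   Order.Total, which Hierarchy Builder rejects for want of a join below
   Num.RealDomain. *)
#[short(type="ordZmodType")]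
HB.structure Definition OrdZmodule :=
  { G of Num.POrderedZmodule G & POrderedZmodule_isLinear G }.

Lemma ordzD2l (G : ordZmodType) (z x y : G) : (z + x <= z + y) = (x <= y).
Proof.
apply/idP/idP => [h|]; last exact: ordzD2l_subproof.
by have := ordzD2l_subproof (- z) _ _ h; rewrite !addKr.
Qed.

(* G together with an absorbing top element: None stands for infinity. *)
Definition withinf (G : Type) : Type := option G.
Definition infty {G : Type} : withinf G := None.
Definition fin {G : Type} (x : G) : withinf G := Some x.

(* Inverse of fin; the value 0 at infinity is a dummy one. *)
Definition finpart {G : zmodType} (x : withinf G) : G := odflt 0 x.

Section WithInf.
Variable G : ordZmodType.
Implicit Types x y z : withinf G.

HB.instance Definition _ := Choice.copy (withinf G) (option G).

Definition addi x y : withinf G :=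
  if (x, y) is (Some a, Some b) then Some (a + b) else None.

Definition lei x y : bool :=
  match x, y with
  | _, None => true
  | None, Some _ => false
  | Some a, Some b => a <= b
  end.

Fact addiA : associative addi.
Proof. by case=> [a|] [b|] [c|] //=; rewrite /addi addrA. Qed.

Fact addiC : commutative addi.
Proof. by case=> [a|] [b|] //=; rewrite /addi addrC. Qed.

Fact add0i : left_id (fin 0) addi.
Proof. by case=> [a|] //=; rewrite /addi /= add0r. Qed.

HB.instance Definition _ := GRing.isNmodule.Build (withinf G) addiA addiC add0i.

Fact lei_refl : reflexive lei.
Proof. by case=> [a|] /=. Qed.

Fact lei_anti : antisymmetric lei.
Proof. by case=> [a|] [b|] //= /le_anti ->. Qed.

Fact lei_trans : transitive lei.
Proof. by case=> [a|] [b|] [c|] //=; apply: le_trans. Qed.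

Fact lei_total : total lei.
Proof. by case=> [a|] [b|] //=; apply: ordz_total. Qed.

HB.instance Definition _ :=
  Order.Le_isPOrder.Build ring_display (withinf G) lei_refl lei_anti lei_trans.
HB.instance Definition _ :=
  Order.POrder_isTotal.Build ring_display (withinf G) lei_total.

Lemma fin_add (a b : G) : fin a + fin b = fin (a + b).
Proof. by []. Qed.

Lemma fin_le (a b : G) : (fin a <= fin b) = (a <= b).
Proof. by []. Qed.

End WithInf.

Record valuation (K : fieldType) (G : ordZmodType) := Valuation {
  valuation_fun :> K -> withinf G;
  val_infty : forall x, valuation_fun x = infty <-> x = 0;
  val_mul : forall x y,
    valuation_fun (x * y) = valuation_fun x + valuation_fun y;
  val_add : forall x y,
    Order.min (valuation_fun x) (valuation_fun y) <= valuation_fun (x + y)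
}.

Definition nontrivial_valuation (K : fieldType) (G : ordZmodType)
  (v : valuation K G) : Prop := exists2 x : K, x != 0 & v x != 0.

Section ResidueField.
Variables (K : fieldType) (G : ordZmodType) (v : valuation K G).

Lemma val0 : v 0 = infty.
Proof. exact/val_infty. Qed.

Lemma val_fin x : x != 0 -> {a : G | v x = fin a}.
Proof.
by move=> x0; case E: (v x) => [a|]; [exists a|case/eqP: x0; apply/val_infty/E].
Qed.

Lemma val1 : v 1 = 0.
Proof.
have [a Ea] := val_fin (oner_neq0 K).
have := val_mul v 1 1; rewrite mulr1 Ea fin_add => -[/eqP].
by rewrite -subr_eq0 opprD addrA subrr add0r oppr_eq0 => /eqP->.
Qed.

Lemma valN x : v (- x) = v x.
Proof.
suff vN1 : v (- 1) = 0 by rewrite -mulN1r val_mul vN1 add0r.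
have [|a Ea] := @val_fin (- 1); first by rewrite oppr_eq0 oner_neq0.
have := val_mul v (- 1) (- 1).
rewrite mulrNN mulr1 val1 Ea fin_add => -[aa].
congr fin; apply/le_anti/andP.
have [a0|a0] := orP (ordz_total a 0).
  by rewrite a0 aa -[leRHS]addr0 ordzD2l a0.
by rewrite a0 aa -[leLHS]addr0 ordzD2l a0.
Qed.

Definition val_ring_pred : {pred K} := fun x => (0 : withinf G) <= v x.

Fact val_ring_subring : subring_closed val_ring_pred.
Proof.
split=> [|x y|x y]; rewrite !unfold_in /val_ring_pred.
- by rewrite val1.
- move=> x0 y0; apply: le_trans (val_add v x (- y)).
  by rewrite valN le_min x0.
- rewrite val_mul; case: (v x) (v y) => [a|] [b|] //.
  rewrite fin_add !fin_le => a0 b0.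
  by apply: le_trans a0 _; rewrite -[leLHS]addr0 ordzD2l.
Qed.

HB.instance Definition _ := GRing.isSubringClosed.Build K val_ring_pred
  val_ring_subring.

Record val_ring := ValRing {
  val_ring_val :> K;
  val_ringP : val_ring_val \in val_ring_pred
}.

HB.instance Definition _ := [isSub for val_ring_val].
HB.instance Definition _ := [Choice of val_ring by <:].
HB.instance Definition _ := [SubChoice_isSubComNzRing of val_ring by <:].

Definition max_ideal : {pred val_ring} := fun x => (0 : withinf G) < v (val x).

Fact max_ideal_closed : idealr_closed max_ideal.
Proof.
split; rewrite ?unfold_in /max_ideal.
- by rewrite raddf0 val0.
- by rewrite rmorph1 val1 ltxx.
move=> a x y; rewrite !unfold_in /max_ideal rmorphD rmorphM /= => x0 y0.
apply: lt_le_trans (val_add v _ _); rewrite lt_min y0 andbT val_mul.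
have := val_ringP a; rewrite unfold_in /val_ring_pred.
case: (v (val_ring_val a)) (v (val_ring_val x)) x0 => [b|] [c|] //=.
rewrite fin_add fin_le => c0 b0; apply: lt_le_trans c0 _.
by rewrite fin_le -[leLHS]add0r ![_ + c]addrC ordzD2l.
Qed.

Fact max_ideal_prime : prime_idealr_closed max_ideal.
Proof.
move=> x y; rewrite !unfold_in /max_ideal rmorphM /= val_mul.
have := val_ringP x; have := val_ringP y; rewrite !unfold_in /val_ring_pred.
rewrite !le_eqVlt => /orP[/eqP<-|->] /orP[/eqP<-|->]; rewrite ?orbT //.
by rewrite addr0 ltxx.
Qed.

HB.instance Definition _ := isIdealr.Build val_ring max_ideal max_ideal_closed.
HB.instance Definition _ :=
  isPrimeIdealrClosed.Build val_ring max_ideal max_ideal_prime.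

Definition residue_field : Type := {ideal_quot max_ideal}.

HB.instance Definition _ := GRing.ComNzRing.on residue_field.

Definition residue_inv (u : residue_field) : residue_field :=
  if u == 0 then 0 else
    \pi_{ideal_quot max_ideal} (insubd (0 : val_ring) (val (repr u))^-1).

Fact residue_mulVf u : u != 0 -> residue_inv u * u = 1.
Proof.
move=> u0; rewrite /residue_inv (negPf u0).
have xu : \pi_{ideal_quot max_ideal} (repr u) = u by rewrite reprK.
set x := repr u in xu *.
have vx : v (val x) = 0.
  have := val_ringP x; rewrite unfold_in /val_ring_pred le_eqVlt.
  case/orP=> [/eqP<-//|xM]; case/negP: u0; rewrite -xu.
  by rewrite -(rmorph0 \pi_{ideal_quot max_ideal}) -Quotient.idealrBE subr0.
have x0 : val x != 0 by apply/eqP=> /(val_infty v); rewrite vx.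
have vxV : v (val x)^-1 = 0.
  by have := val_mul v (val x)^-1 (val x); rewrite mulVf // val1 vx addr0.
rewrite -[X in _ * X]xu -rmorphM -(rmorph1 \pi_{ideal_quot max_ideal}).
congr (\pi _); apply: val_inj; rewrite rmorphM rmorph1.
apply: etrans (mulVf x0); congr (_ * _).
apply: insubdK; rewrite unfold_in /val_ring_pred.
by apply: etrans (lexx (0 : withinf G)); congr (_ <= _).
Qed.

Fact residue_inv0 : residue_inv 0 = 0.
Proof. by rewrite /residue_inv eqxx. Qed.

HB.instance Definition _ :=
  GRing.ComNzRing_isField.Build residue_field residue_mulVf residue_inv0.

End ResidueField.

Section Action.
Variable K : fieldType.
Implicit Types (n : nat) (A B : {poly K}) (g : 'M[K]_2).

Definition mx2 (a b c d : K) : 'M[K]_2 :=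
  \matrix_(i, j) if i == 0 then if j == 0 then a else b
                 else if j == 0 then c else d.

(* (cx + d)^n A((ax + b) / (cx + d)) for g = (a b; c d) and deg A <= n,
   with the denominators cleared: see mobius_actE. *)
Definition mobius_act n A g : {poly K} :=
  \sum_(i < n.+1) A`_i *:
    ((g 0 0 *: 'X + (g 0 1)%:P) ^+ i * (g 1 0 *: 'X + (g 1 1)%:P) ^+ (n - i)).

Lemma mobius_actE n A g (num := g 0 0 *: 'X + (g 0 1)%:P)
    (den := g 1 0 *: 'X + (g 1 1)%:P) :
  (size A <= n.+1)%N -> den != 0 ->
  tofrac (mobius_act n A g) =
    tofrac den ^+ n *
      (map_poly (fun c : K => tofrac c%:P) A).[tofrac num / tofrac den].
Proof.
move=> sA den0; have dF : tofrac den != 0 by rewrite tofrac_eq0.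
rewrite (@horner_coef_wide _ n.+1); last exact: leq_trans (size_poly _ _) sA.
rewrite mulr_sumr rmorph_sum /=; apply: eq_bigr => i _.
rewrite -/num -/den -mul_polyC !rmorphM !rmorphXn /=.
rewrite (@coef_map_id0 _ _ (fun c : K => tofrac c%:P)) ?polyC0 ?tofrac0 //.
have lein : (i <= n)%N by rewrite -ltnS.
have -> : tofrac den ^+ n = tofrac den ^+ (n - i) * tofrac den ^+ i.
  by rewrite -exprD subnK.
rewrite exprMn exprVn [RHS]mulrCA; congr (_ * _).
by rewrite -mulrA [X in _ = _ * X]mulrC divfK ?expf_neq0 // mulrC.
Qed.

Definition upper_triangular_group : {pred 'M[K]_2} :=
  [pred g | (g \in unitmx) && (g 1 0 == 0)].

Definition in_U2_orbit n A B : Prop :=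
  exists2 g, g \in upper_triangular_group & B = mobius_act n A g.

Definition U_poly n A : {poly K} :=
  mobius_act n A (mx2 1 (- (A`_n.-1 / (n%:R * A`_n))) 0 1).

End Action.

Definition multiple_of (G : zmodType) (k : nat) (x : G) : Prop :=
  exists g : G, x = g *+ k.

(* n is the formal degree of B. The coefficients B`_0 and B`_n are nonzero,
   so finpart is applied to finite values only. *)
Definition eisenstein_dumas (K : fieldType) (G : ordZmodType)
    (v : valuation K G) (n : nat) (B : {poly K}) : Prop :=
  [/\ (size B <= n.+1)%N,
      B`_0 * B`_n != 0,
      forall k : nat, (1 < k)%N -> (k %| n)%N ->
        ~ multiple_of k (finpart (v B`_0) - finpart (v B`_n))
    & forall i : nat, (i <= n)%N ->
        v B`_0 *+ (n - i) + v B`_n *+ i <= v B`_i *+ n].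

(* Main.v *)
(* An upper triangular g acts by an affine substitution and a scaling, so if B
   in the orbit of A is Eisenstein-Dumas, then U(A) = c B(e x + t) with e <> 0.
   Since U(A) has no term of degree n - 1, t = - b_(n-1) / (n b_n), where
   v(n) = 0. Condition (D2) at i = n - 1 then gives
   n v(t) >= v(b_0) - v(b_n), and (D1) at k = n makes this strict. For such a t
   the translation x |-> x + t does not change v(b_0) and preserves (D2), while
   x |-> e x changes v(b_0) - v(b_n) by n v(e) only. *)
Require Import Defs.
From mathcomp Require Import all_boot all_order all_algebra.
Import Order.TTheory GRing.Theory Num.Theory.
Local Open Scope ring_scope.

Set Implicit Arguments.
Unset Strict Implicit.

(** * Order and multiples in [G] with infinity adjoined *)

Section WithInfOrder.
Variable G : ordZmodType.
Implicit Types (a b : G) (x y z t : withinf G).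

Lemma lei_infty x : x <= infty.
Proof. by case: x. Qed.

Lemma lei_add2l z x y : x <= y -> z + x <= z + y.
Proof.
case: z x y => [c|] [a|] [b|] //.
by rewrite !fin_add !fin_le ordzD2l.
Qed.

Lemma lei_add x y z t : x <= y -> z <= t -> x + z <= y + t.
Proof.
move=> xy zt; apply: le_trans (lei_add2l x zt) _.
by rewrite ![_ + t]addrC lei_add2l.
Qed.

Lemma lei_mulrn k x y : x <= y -> x *+ k <= y *+ k.
Proof.
move=> xy; elim: k => [|k IHk]; first by rewrite !mulr0n.
by rewrite !mulrS lei_add.
Qed.

Lemma lei_fin_add2l a x y : (fin a + x <= fin a + y) = (x <= y).
Proof.
by case: x y => [b|] [c|] //; rewrite !fin_add !fin_le ordzD2l.
Qed.

Lemma lti_fin_add2l a x y : (fin a + x < fin a + y) = (x < y).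
Proof. by rewrite !ltNge lei_fin_add2l. Qed.

Lemma lti_fin x y : x < y -> {a | x = fin a}.
Proof. by case: x => [a|]; [exists a|rewrite ltNge lei_infty]. Qed.

Lemma fin_mulrn a k : fin a *+ k = fin (a *+ k).
Proof. by elim: k => // k IHk; rewrite !mulrS IHk fin_add. Qed.

(** Only [y] can be infinite: [x < y] makes [x] finite, and adding finite elements preserves strict
    inequalities. *)
Lemma lti_mulrn k x y : (0 < k)%N -> x < y -> x *+ k < y *+ k.
Proof.
case: k => // k _ xy; have [a xa] := lti_fin xy.
rewrite !mulrS xa; apply: lt_le_trans (_ : fin a *+ k + y <= _).
  by rewrite fin_mulrn addrC lti_fin_add2l -xa.
by rewrite [leLHS]addrC; apply: lei_add2l; rewrite lei_mulrn // -xa ltW.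
Qed.

Lemma infty_mulrn k : (0 < k)%N -> (infty : withinf G) *+ k = infty.
Proof. by case: k => // k _; rewrite mulrS. Qed.

End WithInfOrder.

(** * Values of sums, multiples and integers *)

Section Valuation.
Variables (K : fieldType) (G : ordZmodType) (v : valuation K G).
Implicit Types (x y : K) (c : withinf G).

Lemma val_exp x k : v (x ^+ k) = v x *+ k.
Proof.
elim: k => [|k IHk]; first by rewrite expr0 Defs.val1.
by rewrite exprS mulrS val_mul IHk.
Qed.

Lemma val_mulrn x k : v x <= v (x *+ k).
Proof.
elim: k => [|k IHk]; first by rewrite mulr0n Defs.val0 lei_infty.
by rewrite mulrS; apply: le_trans (val_add v _ _); rewrite le_min lexx.
Qed.

(** The bounds concern [n] times the value, as in (D2), because [c] need not be divisible by [n] in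
    [G]. *)
Lemma val_sum_ge (I : Type) (r : seq I) (P : pred I) (F : I -> K) n c :
  (0 < n)%N -> (forall i, P i -> c <= v (F i) *+ n) ->
  c <= v (\sum_(i <- r | P i) F i) *+ n.
Proof.
move=> n0 cF; elim/big_ind: _ => [|x y cx cy|//].
  by rewrite Defs.val0 infty_mulrn // lei_infty.
apply: le_trans (lei_mulrn n (val_add v x y)).
by rewrite minEle; case: ifP.
Qed.

Lemma val_sum_gt (I : Type) (r : seq I) (P : pred I) (F : I -> K) n c :
  (0 < n)%N -> c < infty -> (forall i, P i -> c < v (F i) *+ n) ->
  c < v (\sum_(i <- r | P i) F i) *+ n.
Proof.
move=> n0 coo cF; elim/big_ind: _ => [|x y cx cy|//].
  by rewrite Defs.val0 infty_mulrn.
apply: lt_le_trans (lei_mulrn n (val_add v x y)).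
by rewrite minEle; case: ifP.
Qed.

Lemma val_addl x y : v x < v y -> v (x + y) = v x.
Proof.
move=> xy; apply/le_anti/andP; split.
  have := val_add v (x + y) (- y); rewrite Defs.valN addrK ge_min.
  by case/orP => // /(lt_le_trans xy); rewrite ltxx.
by apply: le_trans (val_add v x y); rewrite le_min lexx ltW.
Qed.

(** If [v n%:R] were positive, [n] would vanish in the residue field, whose characteristic would
    then be a prime dividing [n]. *)
Lemma val_natr n : (0 < n)%N ->
  (forall p : nat, p \in [pchar residue_field v] -> ~~ (p %| n)%N) ->
  v n%:R = 0.
Proof.
move=> n0 char_n; have := val_mulrn 1 n; rewrite Defs.val1 le_eqVlt.
case/orP=> [/eqP<-//|vn].
have n_eq0 : n%:R == 0 :> residue_field v.
  rewrite -(rmorph_nat (\pi_{ideal_quot (@max_ideal K G v)})%qT).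
  rewrite -(rmorph0 (\pi_{ideal_quot (@max_ideal K G v)})%qT).
  rewrite -Quotient.idealrBE subr0.
  by rewrite unfold_in /max_ideal rmorph_nat.
have [p pP] := natf0_pchar n0 n_eq0.
by have := char_n p pP; rewrite (dvdn_pcharf pP) n_eq0.
Qed.

End Valuation.

(** * Coefficients under affine substitutions; the upper triangular action *)

Section Polynomials.
Variable K : fieldType.
Implicit Types (A B : {poly K}) (c e t : K).

Lemma coef_exp_XaddC t j i :
  (('X + t%:P) ^+ j)`_i = t ^+ (j - i) *+ 'C(j, i).
Proof.
rewrite addrC exprDn coef_sum.
under eq_bigr => k _ do
  rewrite coefMn -polyC_exp coefCM coefXn -mulrnAl mulr_natr mulrb.
rewrite -big_mkcond /=; case: (ltnP j i) => [ji|ij].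
  rewrite bin_small // big1 // => k /eqP ik.
  by have := ltn_ord k; rewrite -ik ltnS leqNgt ji.
by rewrite (big_pred1 (Ordinal (ij : i < j.+1)%N)).
Qed.

(** Binomial expansion of each power. For [j < i] the difference [j - i] truncates to 0, but the
    binomial coefficient is 0. *)
Lemma coef_comp_XaddC n B t i : (size B <= n.+1)%N ->
  (B \Po ('X + t%:P))`_i = \sum_(j < n.+1) B`_j * (t ^+ (j - i) *+ 'C(j, i)).
Proof.
move=> sB; rewrite coef_comp_poly.
rewrite (big_ord_widen _ (fun j => B`_j * (('X + t%:P) ^+ j)`_i) sB).
rewrite big_mkcond; apply: eq_bigr => j _; rewrite coef_exp_XaddC.
by case: ltnP => // sBj; rewrite nth_default ?mul0r.
Qed.

Lemma coef_comp_XaddC_subdominant n B t : (size B <= n.+2)%N ->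
  (B \Po ('X + t%:P))`_n = B`_n + B`_n.+1 * t *+ n.+1.
Proof.
move=> sB; rewrite (coef_comp_XaddC _ _ sB) !big_ord_recr /= big1 => [|j _].
  by rewrite add0r subnn binn expr0 mulr1n mulr1 subSnn binSn expr1 mulrnAr.
by rewrite bin_small // mulr0n mulr0.
Qed.

Lemma coef_comp_scaleX B e i : (B \Po (e *: 'X))`_i = e ^+ i * B`_i.
Proof.
rewrite coef_comp_poly.
under eq_bigr => j _ do rewrite exprZn coefZ coefXn mulrA mulr_natr mulrb.
rewrite -big_mkcond /=; case: (ltnP i (size B)) => [iB|Bi].
  by rewrite (big_pred1 (Ordinal iB)) //= mulrC.
rewrite nth_default // mulr0 big1 // => j /eqP ij.
by have := ltn_ord j; rewrite -ij ltnNge Bi.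
Qed.

(** The denominator is the constant [d]; pulling [d] out of [a x + b] gives every term the same
    factor [d ^+ i * d ^+ (n - i)]. *)
Lemma mobius_act_upper n A (g : 'M[K]_2) (a := g 0 0) (b := g 0 1)
    (d := g 1 1) : (size A <= n.+1)%N -> g 1 0 = 0 -> d != 0 ->
  mobius_act n A g = d ^+ n *: (A \Po ((a / d) *: 'X + (b / d)%:P)).
Proof.
move=> sA g10 d0; rewrite /mobius_act g10 scale0r add0r comp_polyE.
rewrite (big_ord_widen _ (fun i => A`_i *: (_ + (b / d)%:P) ^+ i) sA).
rewrite [in RHS]big_mkcond scaler_sumr.
apply: eq_bigr => i _; case: ltnP => [_|sAi]; last first.
  by rewrite nth_default // scale0r scaler0.
have -> : g 0 0 *: 'X + (g 0 1)%:P = d *: ((a / d) *: 'X + (b / d)%:P).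
  rewrite scalerDr scalerA -[d *: _%:P]mul_polyC -polyCM.
  by rewrite ![d * _]mulrC !divfK.
rewrite -polyC_exp [_ * _%:P]mulrC mul_polyC exprZn !scalerA; congr (_ *: _).
by rewrite -mulrA -exprD subnK 1?mulrC // -ltnS.
Qed.

Lemma upper_triangular_diag (g : 'M[K]_2) : g \in @upper_triangular_group K ->
  [/\ g 1 0 = 0, g 0 0 != 0 & g 1 1 != 0].
Proof.
rewrite inE unitmxE unitfE => /andP[dg /eqP g10].
move: dg; rewrite (expand_det_row _ 1) big_ord_recl big_ord1.
have -> : lift ord0 0 = 1 :> 'I_2 by apply: val_inj.
rewrite g10 mul0r add0r mulf_eq0 negb_or => /andP[g11].
rewrite /cofactor det_mx11 !mxE -signr_odd /= expr0 mul1r.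
by have -> : lift 1 0 = 0 :> 'I_2 by apply: val_inj.
Qed.

End Polynomials.

(** * Eisenstein-Dumas polynomials under scaling and translation *)

Section EisensteinDumas.
Variables (K : fieldType) (G : ordZmodType) (v : valuation K G).
Implicit Types (B : {poly K}) (c e t : K).

Lemma eisenstein_dumas_scale n B c e : c != 0 -> e != 0 ->
  eisenstein_dumas v n B ->
  eisenstein_dumas v n (c *: (B \Po (e *: 'X))).
Proof.
move=> c0 e0 [sB B0n D1 D2].
have CE i : (c *: (B \Po (e *: 'X)))`_i = c * (e ^+ i * B`_i).
  by rewrite coefZ coef_comp_scaleX.
have [u vu] : {u | v B`_0 = fin u}.
  by apply: val_fin; apply: contraNneq B0n => ->; rewrite mul0r.
have [w vw] : {w | v B`_n = fin w}.
  by apply: val_fin; apply: contraNneq B0n => ->; rewrite mulr0.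
have [gc vc] := val_fin v c0; have [ge ve] := val_fin v e0.
split.
- apply/leq_sizeP => i ni; rewrite CE (leq_sizeP _ _ sB) //.
  by rewrite !mulr0.
- rewrite !CE expr0 mul1r; move: B0n; rewrite !mulf_eq0 !negb_or.
  by case/andP=> -> ->; rewrite c0 expf_neq0.
- move=> k k1 kn [h Eh]; case: (D1 k k1 kn).
  move: Eh; rewrite !CE !val_mul !val_exp vc ve vu vw mulr0n add0r.
  (* The old difference of end values is the new one plus [n v(e)], a multiple of [k] since [k]
     divides [n]. *)
  rewrite fin_mulrn !fin_add /= => Eh; exists (h + ge *+ (n %/ k)).
  rewrite mulrnDl -Eh -mulrnA divnK //.
  by rewrite opprD opprD addrACA subrr add0r -addrA addrAC -addrA addKr addrC.
(* Both sides of (D2) grow by [n v(c) + i n v(e)]. *)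
- move=> i ni; rewrite !CE !val_mul !val_exp mulr0n add0r !mulrnDl.
  rewrite -!mulrnA [(i * n)%N]mulnC addrACA -mulrnDr subnK //.
  rewrite lei_add2l // addrCA lei_add2l //; exact: D2.
Qed.

Lemma eisenstein_dumas_translate n B t : (0 < n)%N ->
  v B`_0 < v t *+ n + v B`_n -> eisenstein_dumas v n B ->
  eisenstein_dumas v n (B \Po ('X + t%:P)).
Proof.
move=> n0 vt [sB B0n D1 D2].
have [u vu] : {u | v B`_0 = fin u}.
  by apply: val_fin; apply: contraNneq B0n => ->; rewrite mul0r.
have CE i := coef_comp_XaddC t i sB.
have Cn : (B \Po ('X + t%:P))`_n = B`_n.
  rewrite CE big_ord_recr /= big1 ?add0r => [|j _].
    by rewrite subnn binn mulr1n expr0 mulr1.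
  by rewrite bin_small // mulr0n mulr0.
(* (D2) at [j] bounds the [j]-th term of coefficient [i]; [j - i] copies of [n v(t) + v(b_n)] are
   grouped so that each can be compared with [v(b_0)]. *)
have term i j : (i <= j <= n)%N ->
    v B`_0 *+ (n - j) + v B`_n *+ i + (v t *+ n + v B`_n) *+ (j - i)
      <= v (B`_j * (t ^+ (j - i) *+ 'C(j, i))) *+ n.
  case/andP=> ij jn.
  have -> : v B`_0 *+ (n - j) + v B`_n *+ i + (v t *+ n + v B`_n) *+ (j - i) =
      v B`_0 *+ (n - j) + v B`_n *+ j + v (t ^+ (j - i)) *+ n.
    rewrite -[in v B`_n *+ j](subnKC ij) mulrnDr mulrnDl val_exp.
    rewrite -!mulrnA [(n * _)%N]mulnC -!addrA.
    by congr (_ + (_ + _)); rewrite addrC.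
  rewrite val_mul mulrnDl; apply: lei_add; first exact: D2.
  by apply: lei_mulrn; apply: val_mulrn.
(* The new constant term is [b_0] plus terms with [j > 0], each of value strictly above [v(b_0)]. *)
have vC0 : v (B \Po ('X + t%:P))`_0 = v B`_0.
  rewrite CE big_ord_recl subn0 bin0 mulr1n expr0 mulr1.
  apply: val_addl.
  suff: v B`_0 *+ n < v (\sum_(j < n) B`_(lift ord0 j) *
      (t ^+ (lift ord0 j - 0) *+ 'C(lift ord0 j, 0))) *+ n.
    by rewrite !ltNge; apply: contra; apply: lei_mulrn.
  apply: val_sum_gt => // [|j _]; first by rewrite vu fin_mulrn.
  have jn : (0 <= lift ord0 j <= n)%N := ltn_ord j.
  apply: lt_le_trans (term _ _ jn).
  have -> : v B`_0 *+ n = v B`_0 *+ (n - lift ord0 j) + v B`_0 *+ lift ord0 j.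
    by rewrite -mulrnDr subnK.
  rewrite mulr0n addr0 subn0 vu !fin_mulrn lti_fin_add2l -fin_mulrn -vu.
  exact: lti_mulrn.
split; rewrite ?Cn ?vC0 //.
- apply/leq_sizeP => i ni; rewrite CE big1 // => j _.
  by rewrite bin_small ?mulr0n ?mulr0 // (leq_trans (ltn_ord j)).
- move: B0n; rewrite !mulf_eq0 !negb_or => /andP[_ ->]; rewrite andbT.
  by apply/eqP => /(val_infty v); rewrite vC0 vu.
move=> i ni; rewrite CE; apply: val_sum_ge => // j _.
have [ji|ij] := ltnP j i.
  by rewrite bin_small // mulr0n mulr0 Defs.val0 infty_mulrn // lei_infty.
have jn : (j <= n)%N := ltn_ord j.
apply: le_trans (term i j _); last by rewrite ij.
(* Replacing the [j - i] grouped copies by [v(b_0)] leaves [(n - j) + (j - i) = n - i] copies of it,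
   as (D2) requires. *)
rewrite addrAC [leRHS]addrC [leLHS]addrC lei_add2l //.
have -> : (n - i = (n - j) + (j - i))%N by rewrite addnBA // subnK.
by rewrite mulrnDr lei_add2l // lei_mulrn // ltW.
Qed.

(** The equation on [t] says that [B(x + t)] has no term of degree [n - 1]. *)
Lemma eisenstein_dumas_shift n B t : (1 < n)%N -> v n%:R = 0 ->
  eisenstein_dumas v n B -> B`_n.-1 + B`_n * t *+ n = 0 ->
  v B`_0 < v t *+ n + v B`_n.
Proof.
move=> n1 vn [sB B0n D1 D2] Et.
have [u vu] : {u | v B`_0 = fin u}.
  by apply: val_fin; apply: contraNneq B0n => ->; rewrite mul0r.
have [w vw] : {w | v B`_n = fin w}.
  by apply: val_fin; apply: contraNneq B0n => ->; rewrite mulr0.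
have vB : v B`_n.-1 = v B`_n + v t.
  move/eqP: Et; rewrite addr_eq0 => /eqP->.
  by rewrite Defs.valN -mulr_natr !val_mul vn addr0.
have := D2 n.-1 (leq_pred n); rewrite vB mulrnDl.
have -> : (n - n.-1 = 1)%N by rewrite -{1}(ltn_predK n1) subSnn.
have -> : v B`_n *+ n = v B`_n *+ n.-1 + v B`_n.
  by rewrite -mulrSr (ltn_predK n1).
rewrite mulr1n [leLHS]addrC -addrA vw fin_mulrn lei_fin_add2l -vw.
rewrite [leRHS]addrC le_eqVlt.
(* Equality is impossible for [t = 0], where the right side is infinite; otherwise it gives
   [v(b_0) - v(b_n) = n v(t)], against (D1) at [k = n]. *)
case/orP=> // /eqP; rewrite vu vw; case: (v t) => [h|] //; last first.
  by rewrite infty_mulrn 1?ltnW.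
rewrite fin_mulrn fin_add => -[Eu]; case: (D1 n n1 (dvdnn n)).
by exists h; rewrite vu vw /= Eu addrK.
Qed.

End EisensteinDumas.

(** * From an Eisenstein-Dumas orbit member to [U_poly] *)

Theorem theorem2p5 (K : fieldType) (G : ordZmodType) (v : valuation K G)
    (v_nontrivial : nontrivial_valuation v)
    (n : nat) (n_gt1 : (1 < n)%N)
    (A : {poly K}) (deg_A : size A = n.+1)
    (char_n : forall p : nat, p \in [pchar residue_field v] -> ~~ (p %| n)%N)
    (ED_orbit : exists2 B : {poly K},
       in_U2_orbit n A B & eisenstein_dumas v n B) :
  U_poly n A = A \Po ('X - (A`_n.-1 / (n%:R * A`_n))%:P) /\
  eisenstein_dumas v n (U_poly n A).
Proof.
have n0 := ltnW n_gt1; have sA : (size A <= n.+1)%N by rewrite deg_A.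
have An : A`_n != 0.
  by rewrite -[n]/n.+1.-1 -deg_A -lead_coefE lead_coef_eq0 -size_poly_eq0 deg_A.
have vn := val_natr n0 char_n.
have nK : n%:R != 0 :> K by apply/eqP => E; move: vn; rewrite E Defs.val0.
set s := A`_n.-1 / _.
have UE : U_poly n A = A \Po ('X - s%:P).
  rewrite /U_poly mobius_act_upper ?mxE ?oner_neq0 //=.
  by rewrite expr1n scale1r !divr1 scale1r polyCN.
split=> //; rewrite UE.
case: ED_orbit => B [g /upper_triangular_diag[g10 a0 d0]].
rewrite mobius_act_upper //; set p := _ / _; set q := _ / _; set d := g 1 1.
move=> BE EDB.
have p0 : p != 0 by rewrite mulf_neq0 ?invr_neq0.
(* Since [B(x) = d^n A(p x + q)], solving [p y + q = x - s] gives [y = x / p + t]. *)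
pose t := (- s - q) / p.
have CE : A \Po ('X - s%:P) =
    d ^- n *: ((B \Po ('X + t%:P)) \Po (p^-1 *: 'X)).
  rewrite BE !comp_polyZ scalerA mulVf ?expf_neq0 // scale1r -!comp_polyA.
  congr (_ \Po _); rewrite !(comp_polyD, comp_polyZ, comp_polyX, comp_polyC).
  rewrite scalerDr scalerA divff // scale1r -[p *: t%:P]mul_polyC -polyCM.
  by rewrite mulrC divfK // polyCB polyCN -addrA subrK.
have sB : (size B <= n.+1)%N by case: EDB.
have coef_pred (P : {poly K}) r : (size P <= n.+1)%N ->
    (P \Po ('X + r%:P))`_n.-1 = P`_n.-1 + P`_n * r *+ n.
  rewrite -[n in (_ <= n.+1)%N](ltn_predK n_gt1).
  by move=> /(coef_comp_XaddC_subdominant r) ->; rewrite (ltn_predK n_gt1).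
(* The choice of [s] makes [n a_n s = a_(n-1)]. *)
have Cpred : (A \Po ('X - s%:P))`_n.-1 = 0.
  rewrite -polyCN coef_pred // mulrN mulNrn -mulr_natr mulrC mulrA.
  by rewrite [X in _ - X]mulrC divfK ?subrr // mulf_neq0.
(* The scalings only multiply the coefficient of degree [n - 1] by a nonzero constant, so it
   vanishes in [B(x + t)] too. *)
have Et : B`_n.-1 + B`_n * t *+ n = 0.
  rewrite -coef_pred //; apply/eqP; move/eqP: Cpred.
  rewrite CE coefZ coef_comp_scaleX !mulf_eq0 invr_eq0 !expf_eq0.
  by rewrite invr_eq0 (negPf p0) (negPf d0) !andbF.
rewrite CE; apply: eisenstein_dumas_scale.
- by rewrite invr_neq0 ?expf_neq0.
- by rewrite invr_neq0.
apply: eisenstein_dumas_translate => //.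
exact: eisenstein_dumas_shift.
Qed.
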